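(* The category $\mathbf{PAKF}$ of perfect augmented Kripke frames and paK-functions is a proper subcategory of the category $\mathbf{mKF}$ of mk-frames and mk-functions; that is, every perfect augmented Kripke frame $(X,\Omega,R,E)$ is an mk-frame $(X,\Omega,R,E)$ (with $R$ as the order), every paK-function between perfect augmented Kripke frames is an mk-function, and not every mk-frame is a perfect augmented Kripke frame.
   Context: Relation notation: for $R\subseteq X\times X$, $R(Z)=\{y:(x,y)\in R$ for some $x\in Z\}$, $R(x)=R(\{x\})$, $R^{-1}(V)=\{x: R(x)\cap V\neq\emptyset\}$; the composition $R\circ T$ is $\{(x,y): \exists z\,((x,z)\in T,\ (z,y)\in R)\}$. In a poset $(Y]$ and $[Y)$ are the down- and up-sets generated by $Y$, $[x)=[\{x\})$. A perfect augmented Kripke frame (paK-frame) is $(X,\Omega,R,E)$ such that: $(X,R)$ is a nonempty poset, $E$ is an equivalence relation on $X$, $R\circ E\subseteq E\circ R$; for $T=R$ and for $T=E\circ R$: $(X,T)$ is a nonempty quasi-ordered set, $(X,\Omega)$ is a Stone space (compact, Hausdorff, zero-dimensional), $T(x)$ is closed for all $x$, and $T^{-1}(A)$ is clopen for every clopen $A$; and $E(A)$ is clopen for every $R$-increasing clopen $A$. A paK-function $f:(X_1,\Omega_1,R_1,E_1)\to(X_2,\Omega_2,R_2,E_2)$ is a continuous map such that for $(T_1,T_2)=(R_1,R_2)$ and $(T_1,T_2)=(E_1\circ R_1,E_2\circ R_2)$: $(f(x),y)\in T_2$ iff there is $z$ with $(x,z)\in T_1$ and $f(z)=y$; and $(f(x),y)\in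 E_2$ iff there is $z$ with $(x,z)\in E_1$ and $(y,f(z))\in R_2$. A Priestley space is a compact space with a partial order such that whenever $x\not\le y$ there is a clopen increasing $U$ with $x\in U$, $y\notin U$; $D(X)$ is the set of clopen increasing subsets. An mk-frame is $(X,\Omega,\le,E)$ where $(X,\le)$ is a nonempty poset, $E$ an equivalence relation, and: (mk1) $\le\circ E\subseteq E\circ\le$; (mk2) $(X,\Omega,\le)$ is a Priestley space; (mk3) $E(A)$ is closed for all closed $A$; (mk4) $E(U)$ is open for all $U\in D(X)$; (mk5) $(E(X\setminus U)]$ is open for all $U\in D(X)$. An mk-function is an order-preserving continuous map $f$ with (mkf1) $(x,y)\in E_1\Rightarrow (f(x),f(y))\in E_2$; (mkf2) $E_2(f(x))\subseteq(f(E_1(x))]$; (mkf3) $E_2([f(x)))\subseteq[f(E_1([x))))$ for all $x$. *)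

(* Defs.v *)
From Corelib Require Relation_Definitions.
From mathcomp Require Import all_boot all_order.
From mathcomp Require Import all_classical.
From mathcomp Require Import topology.

Set Implicit Arguments.
Unset Strict Implicit.
Unset Printing Implicit Defensive.

Local Open Scope classical_set_scope.
Local Open Scope relation_scope.

(* A relation R on X is a subset of X * X.  The library's composition
   B \; A = [set xy | exists2 z, A (xy.1, z) & B (z, xy.2)] applies A first, so
   E \; R is E o R: follow R, then E. *)

Definition is_poset (X : Type) (R : set (X * X)) : Prop :=
  [set: X] !=set0 /\ Relation_Definitions.order X (curry R).

Definition is_qoset (X : Type) (R : set (X * X)) : Prop :=
  [set: X] !=set0 /\ Relation_Definitions.preorder X (curry R).

Definition is_equiv (X : Type) (E : set (X * X)) : Prop :=
  Relation_Definitions.equivalence X (curry E).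

Definition rel_image (X : Type) (R : set (X * X)) (Z : set X) : set X :=
  [set y | exists2 x, Z x & R (x, y)].

Definition rel_section (X : Type) (R : set (X * X)) (x : X) : set X :=
  rel_image R [set x].

Definition rel_preimage (X : Type) (R : set (X * X)) (V : set X) : set X :=
  [set x | (rel_section R x `&` V) !=set0].

Definition down_set (X : Type) (R : set (X * X)) (Y : set X) : set X :=
  [set x | exists2 y, Y y & R (x, y)].

Definition up_set (X : Type) (R : set (X * X)) (Y : set X) : set X :=
  [set x | exists2 y, Y y & R (y, x)].

Definition increasing (X : Type) (R : set (X * X)) (U : set X) : Prop :=
  forall x y, U x -> R (x, y) -> U y.

(* The library's zero_dimensional only asks that distinct points be separated
   by clopen sets; here the clopen sets are required to form a basis. *)
Definition stone_space (X : topologicalType) : Prop :=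
  [/\ compact [set: X], hausdorff_space X & basis (@clopen X)].

Definition perfect_kripke_frame (X : topologicalType) (T : set (X * X)) : Prop :=
  [/\ is_qoset T,
      stone_space X,
      forall x : X, closed (rel_section T x) &
      forall A : set X, clopen A -> clopen (rel_preimage T A)].

Record paK_frame (X : topologicalType) (R E : set (X * X)) : Prop := PaKFrame {
  paK_poset : is_poset R ;
  paK_equiv : is_equiv E ;
  paK_comp : R \; E `<=` E \; R ;
  paK_perfect : perfect_kripke_frame R ;
  paK_perfect_comp : perfect_kripke_frame (E \; R) ;
  paK_clopen : forall A : set X,
    increasing R A -> clopen A -> clopen (rel_image E A)
}.

Definition back_and_forth (X1 X2 : Type) (T1 : set (X1 * X1))
    (T2 : set (X2 * X2)) (f : X1 -> X2) : Prop :=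
  forall x y, T2 (f x, y) <-> exists z, T1 (x, z) /\ f z = y.

Record paK_function (X1 X2 : topologicalType) (R1 E1 : set (X1 * X1))
    (R2 E2 : set (X2 * X2)) (f : X1 -> X2) : Prop := PaKFunction {
  paKf_continuous : continuous f ;
  paKf_order : back_and_forth R1 R2 f ;
  paKf_comp : back_and_forth (E1 \; R1) (E2 \; R2) f ;
  paKf_equiv : forall x y,
    E2 (f x, y) <-> exists z, E1 (x, z) /\ R2 (y, f z)
}.

Definition clopen_increasing (X : topologicalType) (R : set (X * X)) :
    set (set X) :=
  [set U | clopen U /\ increasing R U].

Definition priestley_space (X : topologicalType) (R : set (X * X)) : Prop :=
  [/\ compact [set: X],
      Relation_Definitions.order X (curry R) &
      forall x y : X, ~ R (x, y) ->
        exists U : set X, [/\ clopen_increasing R U, U x & ~ U y]].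

Record mk_frame (X : topologicalType) (R E : set (X * X)) : Prop := MkFrame {
  mk_poset : is_poset R ;
  mk_equiv : is_equiv E ;
  mk1 : R \; E `<=` E \; R ;
  mk2 : priestley_space R ;
  mk3 : forall A : set X, closed A -> closed (rel_image E A) ;
  mk4 : forall U : set X, clopen_increasing R U -> open (rel_image E U) ;
  mk5 : forall U : set X, clopen_increasing R U ->
    open (down_set R (rel_image E (~` U)))
}.

Record mk_function (X1 X2 : topologicalType) (R1 E1 : set (X1 * X1))
    (R2 E2 : set (X2 * X2)) (f : X1 -> X2) : Prop := MkFunction {
  mkf_order : forall x y, R1 (x, y) -> R2 (f x, f y) ;
  mkf_continuous : continuous f ;
  mkf1 : forall x y, E1 (x, y) -> E2 (f x, f y) ;
  mkf2 : forall x,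
    rel_section E2 (f x) `<=` down_set R2 (f @` rel_section E1 x) ;
  mkf3 : forall x,
    rel_image E2 (up_set R2 [set f x]) `<=`
      up_set R2 (f @` rel_image E1 (up_set R1 [set x]))
}.

(* Main.v *)
Require Import Defs.
From mathcomp Require Import all_boot all_order.
From mathcomp Require Import all_classical.
From mathcomp Require Import topology.
From mathcomp Require Import cantor.

Set Implicit Arguments.
Unset Strict Implicit.
Unset Printing Implicit Defensive.

(** In a perfect augmented Kripke frame put T := E o R.  The relation T is
    closed, because points outside T(x) are separated from x by clopen sets
    and their T-preimages.  The key fact is E = T `&` T^-1: the T-cluster C of
    a point is compact, so it has an R-maximal element m, and from
    m R z E y with y in C one gets z in C, hence z = m and m E y.  Thus E is a
    closed relation on a compact space and maps closed sets to closed sets; the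
    remaining mk-axioms are immediate, since (E(A)] = T^-1(A).

    The inclusion is proper because an mk-frame need not be an Esakia space: on
    the Cantor space, let E be equality and let the only strict inequality be
    p < q.  For a clopen A containing q but not p the R-preimage of A is
    A `|` [set p], which is not open as p is not isolated. *)

Local Open Scope classical_set_scope.
Local Open Scope relation_scope.

Section RelationImages.
Variable X : Type.
Implicit Types (R E : set (X * X)) (A U : set X).

Lemma rel_sectionE R x : rel_section R x = [set y | R (x, y)].
Proof. by apply/seteqP; split=> y; [case=> _ -> | exists x]. Qed.

Lemma rel_preimageE R A : rel_preimage R A = down_set R A.
Proof.
rewrite /rel_preimage; apply/seteqP; split=> x.
  by case=> y []; rewrite rel_sectionE => Rxy Ay; exists y.
by case=> y Ay Rxy; exists y; split=> //; rewrite rel_sectionE.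
Qed.

Lemma rel_image_symmetric E A :
  Relation_Definitions.symmetric X (curry E) -> rel_image E A = down_set E A.
Proof.
by move=> Esym; apply/seteqP; split=> x [y Ay Exy]; exists y => //; exact: Esym.
Qed.

Lemma rel_image_diagonal A : rel_image diagonal A = A.
Proof. by apply/seteqP; split=> [x [y Ay /diagonalP <-]|x Ax] //; exists x. Qed.

Lemma down_set_comp R E A : down_set (E \; R) A = down_set R (down_set E A).
Proof.
apply/seteqP; split=> x.
  by case=> y Ay [z Rxz Ezy]; exists z => //; exists y.
by case=> z [y Ay Ezy] Rxz; exists y => //; exists z.
Qed.

Lemma sub_down_set R A :
  Relation_Definitions.reflexive X (curry R) -> A `<=` down_set R A.
Proof. by move=> Rrefl x Ax; exists x => //; exact: Rrefl. Qed.

Lemma increasing_setC_down_set R A :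
  Relation_Definitions.transitive X (curry R) -> increasing R (~` down_set R A).
Proof.
move=> Rtrans x y nAx Rxy [z Az Ryz]; apply: nAx.
by exists z => //; exact: Rtrans Rxy Ryz.
Qed.

Lemma down_set_setC_increasing R U :
  Relation_Definitions.reflexive X (curry R) -> increasing R U ->
  down_set R (~` U) = ~` U.
Proof.
move=> Rrefl incU; apply/seteqP; split; last exact: sub_down_set.
by move=> x [y nUy Rxy] Ux; apply: nUy; exact: incU Ux Rxy.
Qed.

Definition symmetric_part R : set (X * X) := R `&` R^-1.

Definition premaximal_in R A (m : X) : Prop :=
  A m /\ forall y, A y -> R (m, y) -> R (y, m).

Lemma symmetric_part_comp R E :
  Relation_Definitions.order X (curry R) -> is_equiv E ->
  Relation_Definitions.transitive X (curry (E \; R)%relation) ->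
  (forall x, exists m,
    premaximal_in R (rel_section (symmetric_part (E \; R)) x) m) ->
  symmetric_part (E \; R) = E.
Proof.
move=> [Rrefl _ Ranti] [Erefl Etrans Esym] Ttrans max_cluster.
have ET x y : E (x, y) -> (E \; R) (x, y) by exists x => //; exact: Rrefl.
apply/seteqP; split=> [[x y] [Txy Tyx]|[x y] Exy]; last first.
  by split; apply: ET => //; exact: Esym.
have [m []] := max_cluster x; rewrite rel_sectionE => -[/= Txm Tmx] max_m.
have mE z : (E \; R) (x, z) -> (E \; R) (z, x) -> E (m, z).
  move=> Txz Tzx.
  have [w Rmw Ewz] : (E \; R) (m, z) by exact: Ttrans Tmx Txz.
  suff Rwm : R (w, m) by rewrite (Ranti m w).
  apply: max_m => //; split.
    by apply: Ttrans Txz _; apply: ET; exact: Esym.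
  by apply: Ttrans Tzx; exact: ET.
have Emx : E (m, x) by apply: mE; apply: ET; exact: Erefl.
by apply: (Etrans _ m); [exact: Esym | apply: mE].
Qed.

End RelationImages.

Section ClosedRelations.
Variable X : topologicalType.
Implicit Types (R T : set (X * X)) (A C : set X).

Lemma closed_rel_section T x : closed T -> closed (rel_section T x).
Proof.
rewrite rel_sectionE; apply: (preimage_closed (f := pair x)) => y _.
by apply: cvg_pair => //=; exact: cvg_cst.
Qed.

Lemma closed_symmetric_part T : closed T -> closed (symmetric_part T).
Proof.
move=> clT; apply: closedI => //.
apply: (preimage_closed (f := fun xy : X * X => (xy.2, xy.1))) clT => z _.
by apply: cvg_pair; [exact: cvg_snd | exact: cvg_fst].
Qed.

Lemma compact_rel_image_closed T A :
  closed T -> compact A -> closed (rel_image T A).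
Proof.
move=> clT /compact_near_coveringP covA y clAy; apply: contrapT => nAy.
have avoidA : \forall z \near y, A `<=` [set x | ~ T (x, z)].
  apply: covA => x Ax; have : nbhs (x, y) (~` T).
    apply: open_nbhs_nbhs; split; first exact: closed_openC.
    by move=> Txy; apply: nAy; exists x.
  by apply: filterS => -[].
by have [z [[x Ax Txz] /(_ x Ax)]] := clAy _ avoidA.
Qed.

Lemma compact_chain_upper_bound R A C :
  Relation_Definitions.preorder X (curry R) ->
  (forall x, closed (rel_section R x)) -> compact C ->
  A `<=` C -> A !=set0 -> total_on A (curry R) ->
  exists2 t, C t & forall s, A s -> R (s, t).
Proof.
move=> [Rrefl Rtrans] clR cC AC [a Aa] totA.
pose F := filter_from A (fun s => C `&` rel_section R s).
have FF : ProperFilter F.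
  apply: filter_from_proper => [|s As]; last first.
    by exists s; rewrite rel_sectionE; split; [exact: AC | exact: Rrefl].
  apply: filter_from_filter => [|s t As At]; first by exists a.
  have [Rst|Rts] := totA s t As At; [exists t | exists s] => // z [Cz];
    rewrite !rel_sectionE => Rz; do 2?split=> //; exact: Rtrans Rz.
have [|t [Ct clt]] := cC F FF; first by exists a => // z [].
exists t => // s As; suff : rel_section R s t by rewrite rel_sectionE.
by apply: clR => B nB; apply: clt nB; exists s => // z [].
Qed.

Lemma compact_premaximal R C :
  Relation_Definitions.preorder X (curry R) ->
  (forall x, closed (rel_section R x)) -> compact C -> C !=set0 ->
  exists m, premaximal_in R C m.
Proof.
move=> preR clR cC [c Cc]; case: (preR) => Rrefl Rtrans.
pose r (s t : {x | C x}) := `[< R (sval s, sval t) >].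
have [|||[m Cm] maxm] := @ZL_preorder {x | C x} (exist _ c Cc) r.
- by move=> s; apply/asboolP; exact: Rrefl.
- by move=> s t u /asboolP Rst /asboolP Rtu; apply/asboolP; exact: Rtrans Rtu.
- move=> A totA; have [->|/set0P A0] := eqVneq A set0.
    by exists (exist _ c Cc).
  have [|||t Ct ubt] :=
      compact_chain_upper_bound preR clR cC (A := sval @` A).
  + by move=> _ [[s Cs] _ <-].
  + exact: image_nonempty.
  + move=> _ _ [s As <-] [t At <-].
    by case: (totA s t As At) => /asboolP; [left | right].
  + by exists (exist _ t Ct) => s As; apply/asboolP; apply: ubt; exists s.
exists m; split=> // y Cy Rmy.
by have /asboolP := maxm (exist _ y Cy) (asboolT Rmy).
Qed.

End ClosedRelations.

Section PerfectKripkeFrames.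
Variable X : topologicalType.
Implicit Types (R T : set (X * X)) (A : set X).

Lemma stone_clopen_separation A y :
  stone_space X -> closed A -> ~ A y ->
  exists V, [/\ clopen V, V y & V `<=` ~` A].
Proof.
move=> [_ _ [_ basisX]] clA nAy.
have /basisX[V [clV Vy] VA] : nbhs y (~` A).
  by apply: open_nbhs_nbhs; split=> //; exact: closed_openC.
by exists V.
Qed.

Lemma clopen_down_set T A :
  perfect_kripke_frame T -> clopen A -> clopen (down_set T A).
Proof. by move=> [_ _ _ preT]; rewrite -rel_preimageE; exact: preT. Qed.

Lemma perfect_kripke_separation T x y :
  perfect_kripke_frame T -> ~ T (x, y) ->
  exists V, [/\ clopen V, V y & ~ down_set T V x].
Proof.
move=> [_ stX clT _] nTxy.
have [|V [clV Vy VT]] := stone_clopen_separation stX (clT x) (y := y).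
  by rewrite rel_sectionE.
by exists V; split=> // -[z /VT + Txz]; apply; rewrite rel_sectionE.
Qed.

Lemma perfect_kripke_closed T : perfect_kripke_frame T -> closed T.
Proof.
move=> kT [x y] clTxy; apply: contrapT => nTxy.
have [V [[oV clV] Vy nVx]] := perfect_kripke_separation kT nTxy.
have [_ clTV] := clopen_down_set kT (conj oV clV).
have [|[a b] [Tab [/= nVa Vb]]] := clTxy ((~` down_set T V) `*` V).
  exists (~` down_set T V, V) => //=.
  by split; apply: open_nbhs_nbhs; split=> //; exact: closed_openC.
by apply: nVa; exists b.
Qed.

Lemma perfect_kripke_priestley R :
  Relation_Definitions.order X (curry R) -> perfect_kripke_frame R ->
  priestley_space R.
Proof.
move=> oR kR; case: (oR) => Rrefl Rtrans _.
have [_ [cX _ _] _ _] := kR; split=> // x y nRxy.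
have [V [clV Vy nVx]] := perfect_kripke_separation kR nRxy.
exists (~` down_set R V); split=> //; last by apply; exact: sub_down_set.
split; first exact: clopenC V (clopen_down_set kR clV).
exact: increasing_setC_down_set.
Qed.

End PerfectKripkeFrames.

Section PaKFrames.
Variables (X : topologicalType) (R E : set (X * X)).
Hypothesis paKX : paK_frame R E.

Lemma paK_compact : compact [set: X].
Proof. by have [_ [cX _ _] _ _] := paK_perfect paKX. Qed.

Lemma paK_symmetric_part : symmetric_part (E \; R) = E.
Proof.
have [[_ oR] eE _ kR kT _] := paKX.
have [_ _ clR _] := kR; have [[_ [Trefl Ttrans]] _ _ _] := kT.
apply: symmetric_part_comp => // x; apply: compact_premaximal => //.
- by case: oR.
- apply: (subclosed_compact _ paK_compact) => //; apply: closed_rel_section.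
  by apply: closed_symmetric_part; exact: perfect_kripke_closed.
- by exists x; rewrite rel_sectionE; split; exact: Trefl.
Qed.

Lemma paK_equiv_closed : closed E.
Proof.
rewrite -paK_symmetric_part; apply: closed_symmetric_part.
by apply: perfect_kripke_closed; exact: paK_perfect_comp paKX.
Qed.

Lemma paK_frame_mk_frame : mk_frame R E.
Proof.
have [pR eE RE_sub kR kT clopenE] := paKX; split=> //.
- by apply: perfect_kripke_priestley => //; case: pR.
- move=> A clA; apply: compact_rel_image_closed paK_equiv_closed _.
  exact: subclosed_compact clA paK_compact _.
- by move=> U [clU incU]; case: (clopenE U incU clU).
- move=> U [clU _]; rewrite rel_image_symmetric; last by case: eE.
  by rewrite -down_set_comp; case: (clopen_down_set kT (clopenC U clU)).
Qed.

End PaKFrames.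

Lemma paK_function_mk_function (X1 X2 : topologicalType)
    (R1 E1 : set (X1 * X1)) (R2 E2 : set (X2 * X2)) (f : X1 -> X2) :
  Relation_Definitions.reflexive X2 (curry R2) ->
  paK_function R1 E1 R2 E2 f -> mk_function R1 E1 R2 E2 f.
Proof.
move=> Rrefl [cf fR fT fE]; split=> //.
- by move=> x y Rxy; apply/fR; exists y.
- by move=> x y Exy; apply/fE; exists y; split=> //; exact: Rrefl.
- move=> x y; rewrite rel_sectionE => /fE[z [Exz Ryz]].
  by exists (f z) => //; exists z => //; rewrite rel_sectionE.
- move=> x y [z [_ -> Rxz] Ezy].
  have /fT[w [[v Rxv Evw] fwy]] : (E2 \; R2) (f x, y) by exists z.
  exists y; last exact: Rrefl.
  by exists w => //; exists v => //; exists x.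
Qed.

Lemma priestley_mk_frame_diagonal (X : topologicalType) (R : set (X * X)) :
  [set: X] !=set0 -> priestley_space R -> mk_frame R diagonal.
Proof.
move=> X0 priR; case: (priR) => _ oR _; split=> //.
- by split=> [x|x y z|x y] //; rewrite /curry /diagonal /= => ->.
- by move=> [x y] [z /diagonalP /= -> Rzy]; exists y.
- by move=> A; rewrite rel_image_diagonal.
- by move=> U [[oU _] _]; rewrite rel_image_diagonal.
- move=> U [[_ cU] incU]; rewrite rel_image_diagonal.
  by rewrite down_set_setC_increasing//; [exact: closed_openC | case: oR].
Qed.

Definition one_strict_pair (X : Type) (p q : X) : set (X * X) :=
  diagonal `|` [set (p, q)].

Lemma one_strict_pair_order (X : Type) (p q : X) :
  p <> q -> Relation_Definitions.order X (curry (one_strict_pair p q)).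
Proof.
move=> pq; split.
- by move=> x; left.
- by move=> x y z [/diagonalP -> //|[-> ->]] [/diagonalP <-|[_ ->]]; right.
- by move=> x y [//|[-> ->]] [//|[/esym]].
Qed.

Lemma increasing_one_strict_pair (X : Type) (p q : X) (U : set X) :
  increasing (one_strict_pair p q) U <-> (U p -> U q).
Proof.
split=> [incU Up|UpUq x y Ux [/diagonalP <- //|[xp ->]]].
  by apply: incU Up _; right.
by apply: UpUq; rewrite -xp.
Qed.

Lemma one_strict_pair_priestley (X : topologicalType) (p q : X) :
  compact [set: X] -> zero_dimensional X -> p <> q ->
  priestley_space (one_strict_pair p q).
Proof.
move=> cX zX pq; split=> //; first exact: one_strict_pair_order.
move=> x y nRxy.
have xy : x != y by apply/eqP => xy; apply: nRxy; left.
have [U [clU Ux nUy]] := zX _ _ xy.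
have [xp|xp] := eqVneq x p.
  have qy : q != y by apply/eqP => qy; apply: nRxy; right; rewrite xp qy.
  have [V [clV Vq nVy]] := zX _ _ qy.
  exists (U `|` V); split; [|by left|by case].
  by split; [exact: clopenU | apply/increasing_one_strict_pair; right].
have [V [clV Vx nVp]] := zX _ _ xp.
exists (U `&` V); split; [|by []|by case].
by split; [exact: clopenI | apply/increasing_one_strict_pair => -[_ /nVp]].
Qed.

Lemma perfect_kripke_one_strict_pair_open (X : topologicalType) (p q : X) :
  p <> q -> perfect_kripke_frame (one_strict_pair p q) -> open [set p].
Proof.
move=> pq kR; have nRqp : ~ one_strict_pair p q (q, p).
  by case=> [/diagonalP/esym|[/esym]].
have [V [clV Vp nVq]] := perfect_kripke_separation kR nRqp.
have [oRV _] := clopen_down_set kR (clopenC V clV).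
suff -> : [set p] = down_set (one_strict_pair p q) (~` V) `&` V.
  by apply: openI => //; case: clV.
apply/seteqP; split=> x => [->|[[y nVy [/diagonalP -> //|[-> _]]]]] //.
by split=> //; exists q; [move=> Vq; apply: nVq; exists q => //; left | right].
Qed.

Theorem theorem3p2 :
  (forall (X : topologicalType) (R E : set (X * X)),
     paK_frame R E -> mk_frame R E)
  /\ (forall (X1 X2 : topologicalType) (R1 E1 : set (X1 * X1))
        (R2 E2 : set (X2 * X2)) (f : X1 -> X2),
        paK_frame R1 E1 -> paK_frame R2 E2 ->
        paK_function R1 E1 R2 E2 f -> mk_function R1 E1 R2 E2 f)
  /\ ~ (forall (X : topologicalType) (R E : set (X * X)),
          mk_frame R E -> paK_frame R E).
Proof.
split; first exact: paK_frame_mk_frame.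
split.
  move=> X1 X2 R1 E1 R2 E2 f _ [[_ [R2refl _ _]] _ _ _ _ _].
  exact: paK_function_mk_function.
move=> mk_paK.
pose p : cantor_space := fun=> false; pose q : cantor_space := fun=> true.
have pq : p <> q by move=> /(congr1 (@^~ 0%N)).
have priR := one_strict_pair_priestley cantor_space_compact
  cantor_zero_dimensional pq.
have mkX : mk_frame (one_strict_pair p q) diagonal.
  by apply: priestley_mk_frame_diagonal priR; exists p.
apply: (iffLR perfectTP cantor_perfect p).
exact/(perfect_kripke_one_strict_pair_open pq)/paK_perfect/mk_paK/mkX.
Qed.
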